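(* Let $\mathcal{M}=\langle S,A,\mathcal{R},\mathcal{P},\mu,\gamma\rangle$ be an MDP with finite $S$ and $A$, let $Z$ be a finite set, let $\pi_*:S\to\Delta(A)$ be any (target) policy, and let $d^{\mathrm{off}}\in\Delta(S)$ satisfy $d^{\pi_*}(s)>0\Rightarrow d^{\mathrm{off}}(s)>0$. Let $\phi_M:=\mathcal{OPT}_\phi(\mathcal{D}^{\mathrm{off}}_M):S\to Z$ be the representation returned by an oracle on an offline dataset $\mathcal{D}^{\mathrm{off}}_M$, with representation error $\epsilon_{\mathrm{R},\mathrm{T}}(\phi_M)$. Let $\mathcal{D}^{\pi_*}_N=\{(s_i,a_i)\}_{i=1}^N$ be i.i.d. with $s_i\sim d^{\pi_*}$, $a_i\sim\pi_*(s_i)$, drawn independently of $\phi_M$, and let $\pi_{N,Z}:Z\to\Delta(A)$ be the tabular policy resulting from behavioral cloning on $\mathcal{D}^{\pi_*}_N$ with respect to $\phi_M$. Then $$\mathbb{E}_{\mathcal{D}^{\pi_*}_N}\left[\mathrm{PerfDiff}(\pi_{N,Z},\pi_* )\right]\le\left(1+D_{\chi^2}(d^{\pi_*}\|d^{\mathrm{off}})^{1/2}\right)\epsilon_{\mathrm{R},\mathrm{T}}(\phi_M)+C\sqrt{\frac{|Z||A|}{N}},$$ where $C=\frac{2R_{\max}}{(1-\gamma)^2}$.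
   Context: MDP: $S$ is the state space, $A$ is the action space, $\mathcal{R}:S\times A\to[-R_{\max},R_{\max}]$ is the reward function, $\mathcal{P}:S\times A\to\Delta(S)$ is the transition function, $\mu\in\Delta(S)$ is the initial state distribution, $\gamma\in[0,1)$ is the discount. $\Delta(X)$ is the set of probability distributions on $X$. A policy $\pi:S\to\Delta(A)$ generates $s_0\sim\mu$, $a_t\sim\pi(s_t)$, $s_{t+1}\sim\mathcal{P}(s_t,a_t)$. Its performance is $J_{\mathrm{Perf}}(\pi)=\mathbb{E}[\sum_{t\ge0}\gamma^t\mathcal{R}(s_t,a_t)\mid\pi,\mathcal{M}]$, and its visitation distribution is $d^\pi(s)=(1-\gamma)\sum_{t\ge0}\gamma^t\Pr[s_t=s\mid\pi,\mathcal{M}]$. $\mathrm{PerfDiff}(\pi,\pi_* )=|J_{\mathrm{Perf}}(\pi)-J_{\mathrm{Perf}}(\pi_* )|$, and for a latent policy $\pi_Z:Z\to\Delta(A)$ with representation $\phi$, $\mathrm{PerfDiff}(\pi_Z,\pi_* )$ means $\mathrm{PerfDiff}(\pi_Z\circ\phi,\pi_* )$. Offline data and oracle: $\mathcal{D}^{\mathrm{off}}_M$ consists of $M$ independent tuples $(s,a,r,s')$ with $s\sim d^{\mathrm{off}}$, $a\sim\mathrm{Unif}_A$ (uniform on $A$), $r=\mathcal{R}(s,a)$, $s'\sim\mathcal{P}(s,a)$. The oracle is an arbitrary map from the dataset to a representation $\phi_M:S\to Z$ (with accompanying models $\mathcal{R}_Z:Z\times A\to[-R_{\max},R_{\max}]$,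 $\mathcal{P}_Z:Z\times A\to\Delta(S)$). The dataset $\mathcal{D}^{\mathrm{off}}_M$, hence $\phi_M$, is held fixed in the statement; the expectation is over the demonstrations only. The representation error is $$\epsilon_{\mathrm{R},\mathrm{T}}(\phi_M)=\frac{|A|}{1-\gamma}J_{\mathrm{R}}(\mathcal{R}_Z,\phi_M)+\frac{2\gamma|A|R_{\max}}{(1-\gamma)^2}J_{\mathrm{T}}(\mathcal{P}_Z,\phi_M),$$ where $J_{\mathrm{R}},J_{\mathrm{T}}\ge0$ are given by $J_{\mathrm{R}}(\mathcal{R}_Z,\phi)^2=\mathbb{E}_{s\sim d^{\mathrm{off}},a\sim\mathrm{Unif}_A}[(\mathcal{R}(s,a)-\mathcal{R}_Z(\phi(s),a))^2]$ and $J_{\mathrm{T}}(\mathcal{P}_Z,\phi)^2=\frac12\mathbb{E}_{s\sim d^{\mathrm{off}},a\sim\mathrm{Unif}_A}[D_{\mathrm{KL}}(\mathcal{P}(s,a)\|\mathcal{P}_Z(\phi(s),a))]$. Tabular behavioral cloning: $\pi_{N,Z}(a|z)$ is the empirical conditional distribution of actions given the representation value, $\pi_{N,Z}(a|z)=\#\{i:\phi_M(s_i)=z,a_i=a\}/\#\{i:\phi_M(s_i)=z\}$; for $z$ not appearing among the $\phi_M(s_i)$, $\pi_{N,Z}(z)$ is any fixed default distribution on $A$. $D_{\mathrm{KL}}$ is the Kullback–Leibler divergence and $D_{\chi^2}(p\|q)=\sum_s(p(s)-q(s))^2/q(s)$ is the Pearson $\chi^2$ divergence. *)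

(* Defs.v *)
From HB Require Import structures.
From mathcomp Require Import all_boot all_order all_algebra.
From mathcomp Require Import all_classical all_reals all_analysis.
From mathcomp Require Import measurable_realfun.

Set Implicit Arguments.
Unset Strict Implicit.
Unset Printing Implicit Defensive.

Import Order.TTheory GRing.Theory Num.Theory.
Import numFieldNormedType.Exports.

Local Open Scope classical_set_scope.
Local Open Scope ring_scope.

Record dist (R : realType) (T : finType) := Dist {
  pmf :> T -> R;
  dist_ge0 : forall x, 0 <= pmf x;
  dist_sum1 : \sum_x pmf x = 1 }.

Lemma dist_inhabited (R : realType) (T : finType) (p : dist R T) : T.
Proof.
case: (pickP (@predT T)) => [//|T0].
exfalso; have := dist_sum1 p; rewrite big_pred0 => [/eqP|x]; last exact: (T0 x).
by rewrite eq_sym oner_eq0.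
Qed.

(* A law on infinite sequences over a finite alphabet, from consistent
   probabilities of finite prefixes.  The sequence is read off a single
   uniform variable on [0, 1[ by nested interval subdivision; the law is
   characterized by [stream_law_prefix], the construction being irrelevant. *)

(* [x0] only serves to make the type pointed, as required of measurable types *)
Definition stream (X : finType) (x0 : X) : Type := nat -> X.

HB.instance Definition _ (X : finType) (x0 : X) :=
  gen_eqMixin (stream x0).
HB.instance Definition _ (X : finType) (x0 : X) :=
  gen_choiceMixin (stream x0).
HB.instance Definition _ (X : finType) (x0 : X) :=
  isPointed.Build (stream x0) (fun=> x0).

Definition prefix_sets (X : finType) (x0 : X) : set (set (stream x0)) :=
  [set B | exists v : seq X, B = [set w | mkseq w (size v) = v]].

Definition stream_space (X : finType) (x0 : X) :=
  g_sigma_algebraType (@prefix_sets X x0).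

Record prefix_pmf (R : realType) (X : finType) (p : seq X -> R) : Prop := {
  prefix_pmf_ge0 : forall v, 0 <= p v;
  prefix_pmf_nil : p [::] = 1;
  prefix_pmf_rcons : forall v, \sum_x p (rcons v x) = p v }.

Section stream_law.
Context (R : realType) (X : finType) (x0 : X) (p : seq X -> R).
Context (hp : prefix_pmf p).

Let cum (f : X -> R) (x : X) := \sum_(y | (enum_rank y < enum_rank x)%N) f y.

Let hit (f : X -> R) (r : R) (x : X) := (cum f x <= r) && (r < cum f x + f x).

Let cumS f x : cum f x + f x = \sum_(y | (enum_rank y <= enum_rank x)%N) f y.
Proof.
rewrite [RHS](bigD1 x)//= addrC; congr (_ + _); apply: eq_bigl => y.
rewrite ltn_neqAle andbC; congr (_ && _); congr (~~ _).
by apply/eqP/eqP => [/val_inj/enum_rank_inj|->].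
Qed.

Let sub_sum (f : X -> R) (P Q : pred X) : (forall z, 0 <= f z) ->
  (forall z, P z -> Q z) -> \sum_(z | P z) f z <= \sum_(z | Q z) f z.
Proof.
move=> f0 PQ; rewrite [leLHS]big_mkcond [leRHS]big_mkcond.
apply: ler_sum => z _; case: ifPn => [/PQ -> //|_]; by case: ifP.
Qed.

Let hit_uniq f r x y : (forall z, 0 <= f z) -> hit f r x -> hit f r y -> x = y.
Proof.
move=> f0.
wlog xy : x y / (enum_rank x <= enum_rank y)%N.
  move=> h hx hy; case: (leqP (enum_rank x) (enum_rank y)) => [|/ltnW] xy.
    exact: h.
  by apply/esym/h.
move=> /andP[_ rx] /andP[yr _].
case: (ltnP (enum_rank x) (enum_rank y)) => [lxy|yx]; last first.
  by apply/enum_rank_inj/val_inj/eqP; rewrite eqn_leq xy yx.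
suff le : cum f x + f x <= cum f y.
  by have := lt_le_trans rx (le_trans le yr); rewrite ltxx.
rewrite cumS; apply: sub_sum => // z zx; exact: leq_ltn_trans zx lxy.
Qed.

Let hit_ex f r : (forall z, 0 <= f z) -> 0 <= r < \sum_x f x ->
  exists x, hit f r x.
Proof.
move=> f0 /andP[r0 rf].
have ex : exists n, r < \sum_(y | (enum_rank y < n)%N) f y.
  exists #|X|; rewrite (eq_bigl predT)// => y; exact: ltn_ord.
case: (ex_minnP ex) => -[|n] rn nmin.
  by move: rn; rewrite big_pred0// ltNge r0.
have nX : (n < #|X|)%N.
  rewrite ltnNge; apply/negP => Xn.
  have : (n.+1 <= n)%N; last by rewrite ltnn.
  apply: nmin; apply: lt_le_trans rn _.
  rewrite le_eqVlt; apply/orP; left; apply/eqP; apply: eq_bigl => y.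
  have yX := ltn_ord (enum_rank y).
  by rewrite (leq_trans yX Xn) (leq_trans yX (leqW Xn)).
exists (enum_val (Ordinal nX)); apply/andP; split.
  rewrite leNgt; apply/negP; rewrite /cum enum_valK /= => /nmin.
  by rewrite ltnn.
by rewrite cumS enum_valK.
Qed.

Let pick_next f r := odflt x0 [pick x | hit f r x].

Let pick_nextE f r x : (forall z, 0 <= f z) -> 0 <= r < \sum_x f x ->
  (pick_next f r == x) = hit f r x.
Proof.
move=> f0 rf; rewrite /pick_next; case: pickP => [y hy|h] /=.
  by apply/eqP/idP => [<-//|]; exact: hit_uniq.
by have [y hy] := hit_ex f0 rf; move: (h y); rewrite hy.
Qed.

Let next v := (fun x => p (rcons v x)).

Let next_ge0 v z : 0 <= next v z. Proof. exact: prefix_pmf_ge0. Qed.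

Let lo v := \sum_(i < size v) cum (next (take i v)) (nth x0 v i).

Let lo_rcons v x : lo (rcons v x) = lo v + cum (next v) x.
Proof.
rewrite /lo size_rcons big_ord_recr /= nth_rcons ltnn eqxx.
rewrite -cats1 take_size_cat//; congr (_ + _); apply: eq_bigr => i _.
by rewrite cats1 nth_rcons ltn_ord -cats1 takel_cat// ltnW.
Qed.

Let I v : interval R := `[lo v, lo v + p v[.

Fixpoint stream_prefix (u : R) (n : nat) : seq X :=
  if n is m.+1 then let v := stream_prefix u m in
    rcons v (pick_next (next v) (u - lo v))
  else [::].

Let size_prefix u n : size (stream_prefix u n) = n.
Proof. by elim: n => //= n IH; rewrite size_rcons IH. Qed.

Definition stream_of (u : R) : stream_space x0 :=
  fun n => last x0 (stream_prefix u n.+1).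

Let mkseq_stream_of u n : mkseq (stream_of u) n = stream_prefix u n.
Proof.
elim: n => [//|n IH].
by rewrite /mkseq -addn1 iotaD map_cat -/(mkseq _ n) IH /= add0n addn1 cats1
  /stream_of /= last_rcons.
Qed.

Let prefixP u : u \in `[0, 1[ -> forall n v, size v = n ->
  (stream_prefix u n == v) = (u \in I v).
Proof.
move=> u01; elim=> [|n IH] v.
  move=> /size0nil ->; rewrite /= eqxx /I /lo big_ord0 add0r.
  by rewrite (prefix_pmf_nil hp) u01.
case/lastP: v => [//|v x]; rewrite size_rcons => -[sv] /=.
rewrite eqseq_rcons (IH v sv).
have [uv|nuv] /= := boolP (u \in I v); last first.
  apply/esym/negbTE; apply: contra nuv; rewrite !in_itv/= lo_rcons.
  move=> /andP[h1 h2]; apply/andP; split.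
    by apply: le_trans h1; rewrite lerDl sumr_ge0.
  apply: lt_le_trans h2 _; rewrite -addrA lerD2l cumS -(prefix_pmf_rcons hp v).
  exact: sub_sum.
have /eqP -> : stream_prefix u n == v by rewrite IH.
rewrite pick_nextE//; last first.
  rewrite (prefix_pmf_rcons hp v); move: uv; rewrite in_itv/=.
  by rewrite subr_ge0 ltrBlDl.
rewrite /hit in_itv/= lo_rcons lerBrDl ltrBlDl.
by rewrite -[X in _ = _ && (_ < X)]addrA.
Qed.

Let I01 v : [set` I v] `<=` (`[0, 1[ : set R).
Proof.
suff h : 0 <= lo v /\ lo v + p v <= 1.
  move=> u /=; rewrite !in_itv/= => /andP[h1 h2].
  by rewrite (le_trans h.1 h1) (lt_le_trans h2 h.2).
elim/last_ind: v => [|v x [h1 h2]].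
  by rewrite /lo big_ord0 add0r (prefix_pmf_nil hp).
rewrite lo_rcons; split; first by apply: addr_ge0 => //; apply: sumr_ge0.
apply: le_trans h2; rewrite -addrA lerD2l cumS -(prefix_pmf_rcons hp v).
  exact: sub_sum.
Qed.

(* seeds outside [0, 1[ are sent to 0 *)
Let clip (u : R) : R := if u \in `[0, 1[ then u else 0.

Let clip01 u : clip u \in `[0, 1[.
Proof. by rewrite /clip; case: ifPn => // _; rewrite in_itv/= lexx ltr01. Qed.

Let measurable_clip : measurable_fun setT clip.
Proof.
apply: measurable_fun_if => //.
have -> : (fun u : R => u \in `[0, 1[) = (fun u : R => (0 <= u) && (u < 1)).
  by apply/funext => u; rewrite in_itv.
by apply: measurable_and;
  [exact: measurable_fun_ler|exact: measurable_fun_ltr].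
Qed.

Let T (u : R) : stream_space x0 := stream_of (clip u).

Let T_prefix (v : seq X) :
  T @^-1` [set w | mkseq w (size v) = v] = clip @^-1` [set` I v].
Proof.
apply/seteqP; split=> u /=; rewrite /T mkseq_stream_of.
  by move=> /eqP; rewrite prefixP.
by move=> h; apply/eqP; rewrite prefixP.
Qed.

Let measurable_T : measurable_fun setT T.
Proof.
apply: (@measurability _ _ _ (stream_space x0) setT T (@prefix_sets X x0)) => //.
move=> _ [_ [v ->] <-].
by rewrite T_prefix; apply: measurable_clip.
Qed.

Let unif : set R -> \bar R :=
  mrestr lebesgue_measure (measurable_itv `[(0 : R), 1[).

Definition stream_fun : set (stream_space x0) -> \bar R := fun B => unif (T @^-1` B).

Let stream0 : stream_fun set0 = 0%E.
Proof. by rewrite /stream_fun preimage_set0 /unif measure0. Qed.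

Let mT B : measurable B -> measurable (T @^-1` B).
Proof. by move=> mB; rewrite -[X in measurable X]setTI; exact: measurable_T. Qed.

Let stream_ge0 B : (0 <= stream_fun B)%E.
Proof. by rewrite /stream_fun /unif /mrestr; exact: measure_ge0. Qed.

Let stream_sigma_additive : semi_sigma_additive stream_fun.
Proof.
move=> F mF tF mUF; rewrite /stream_fun preimage_bigcup.
apply: (@measure_semi_sigma_additive _ _ _ unif).
- by move=> n; exact: mT.
- apply/trivIsetP => /= i j _ _ ij; rewrite -preimage_setI.
  by move/trivIsetP : tF => /(_ _ _ _ _ ij) ->//; rewrite preimage_set0.
- by rewrite -preimage_bigcup; exact: mT.
Qed.

HB.instance Definition _ := isMeasure.Build _ _ _ stream_fun
  stream0 stream_ge0 stream_sigma_additive.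

Let stream_prefixE (v : seq X) :
  stream_fun [set w | mkseq w (size v) = v] = (p v)%:E.
Proof.
rewrite /stream_fun T_prefix /unif /mrestr.
have -> : clip @^-1` [set` I v] `&` [set` `[0, 1[] = [set` I v].
  apply/seteqP; split=> u /=.
    by rewrite /clip => -[+ u01]; rewrite u01.
  by move=> uI; have u01 := I01 uI; split=> //; rewrite /clip u01.
rewrite lebesgue_measure_itv /= lte_fin ltrDl.
have := prefix_pmf_ge0 hp v; rewrite le_eqVlt => /orP[/eqP <-|->].
  by rewrite ltxx.
by rewrite -EFinB addrC addKr.
Qed.

Let stream_setT : stream_fun setT = 1%E.
Proof.
rewrite -(prefix_pmf_nil hp) -stream_prefixE; congr stream_fun.
by apply/seteqP; split.
Qed.

HB.instance Definition _ := Measure_isProbability.Build _ _ _ stream_fun stream_setT.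

Definition stream_law : probability (stream_space x0) R := stream_fun.

Lemma stream_law_prefix (v : seq X) :
  stream_law [set w | mkseq w (size v) = v] = (p v)%:E.
Proof. exact: stream_prefixE. Qed.

End stream_law.

Record mdp (R : realType) (S A : finType) := MDP {
  r_max : R;
  reward : S -> A -> R;
  reward_bound : forall s a, `|reward s a| <= r_max;
  trans : S -> A -> dist R S;
  init : dist R S;
  discount : R;
  discount_ge0 : 0 <= discount;
  discount_lt1 : discount < 1 }.

Definition policy (R : realType) (X A : finType) := X -> dist R A.

Section trajectories.
Context (R : realType) (S A : finType) (M : mdp R S A) (pi : policy R S A).

Fixpoint path_prob (s : S) (a : A) (v : seq (S * A)) : R :=
  if v is (s', a') :: v' then
    trans M s a s' * pi s' a' * path_prob s' a' v'
  else 1.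

(* Probability that the trajectory (s_0, a_0), (s_1, a_1), ... starts with v *)
Definition traj_prob (v : seq (S * A)) : R :=
  if v is (s, a) :: v' then init M s * pi s a * path_prob s a v' else 1.

Let sum_step (d : dist R S) : \sum_(x : S * A) d x.1 * pi x.1 x.2 = 1.
Proof.
rewrite -(dist_sum1 d) -(pair_bigA _ (fun s a => d s * pi s a))/=.
by apply: eq_bigr => s _; rewrite -mulr_sumr dist_sum1 mulr1.
Qed.

Lemma traj_prefix_pmf : prefix_pmf traj_prob.
Proof.
have path_ge0 v s a : 0 <= path_prob s a v.
  elim: v s a => [|[s' a'] v IH] s a /=; first exact: ler01.
  by rewrite !mulr_ge0 ?dist_ge0.
split => [[|[s a] v]|//|[|[s a] v]] /=.
- exact: ler01.
- by rewrite !mulr_ge0 ?dist_ge0.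
- by rewrite -[RHS](sum_step (init M)); apply: eq_bigr => -[s a] _; rewrite mulr1.
- rewrite -mulr_sumr; congr (_ * _).
  elim: v s a => [|[s' a'] v IH] s a /=; last by rewrite -mulr_sumr IH.
  by rewrite -[RHS](sum_step (trans M s a)); apply: eq_bigr => -[s' a'] _;
    rewrite mulr1.
Qed.

Definition traj_point : S * A :=
  let s := dist_inhabited (init M) in (s, dist_inhabited (pi s)).

Definition traj_law : probability (stream_space traj_point) R :=
  stream_law traj_point traj_prefix_pmf.

Lemma traj_law_prefix (v : seq (S * A)) :
  traj_law [set w | mkseq w (size v) = v] = (traj_prob v)%:E.
Proof. exact: stream_law_prefix. Qed.

Definition discounted_return (w : nat -> S * A) : R :=
  limn (fun n => \sum_(0 <= t < n) discount M ^+ t * reward M (w t).1 (w t).2).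

Definition J_perf : R := (\int[traj_law]_w discounted_return w)%R.

Definition visitation (s : S) : R :=
  (1 - discount M) * limn (fun n => \sum_(0 <= t < n)
    discount M ^+ t * fine (traj_law [set w | (w t).1 = s])).

Definition demo_prob (N : nat) (D : N.-tuple (S * A)) : R :=
  \prod_(i < N) (visitation (tnth D i).1 * pi (tnth D i).1 (tnth D i).2).

Definition demo_expectation (N : nat) (f : N.-tuple (S * A) -> R) : R :=
  \sum_(D : N.-tuple (S * A)) demo_prob D * f D.

End trajectories.

Definition perf_diff (R : realType) (S A : finType) (M : mdp R S A)
  (pi1 pi2 : policy R S A) : R := `|J_perf M pi1 - J_perf M pi2|.

Section divergences.
Context (R : realType) (T : finType).
Local Open Scope ereal_scope.

Definition KL_div (p q : T -> R) : \bar R :=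
  \sum_(x : T) (if p x == 0%R then 0
                else if q x == 0%R then +oo
                else (p x * ln (p x / q x))%:E).

Definition chi2_div (p q : T -> R) : \bar R :=
  \sum_(x : T) (if q x == 0%R then (if p x == 0%R then 0 else +oo)
                else ((p x - q x) ^+ 2 / q x)%:E).

End divergences.

Definition transition_tuple (R : realType) (S A : finType) : Type := S * A * R * S.

Definition offline_prob (R : realType) (S A : finType) (M : mdp R S A)
    (d_off : dist R S) (m : nat) (D : m.-tuple (transition_tuple R S A)) : R :=
  \prod_(i < m) let: (s, a, r, s') := tnth D i in
    d_off s * #|A|%:R^-1 * (r == reward M s a)%:R * trans M s a s'.

Record latent_model (R : realType) (S A Z : finType) (rmax : R) := LatentModel {
  latent_repr : S -> Z;
  reward_Z : Z -> A -> R;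
  reward_Z_bound : forall z a, `|reward_Z z a| <= rmax;
  trans_Z : Z -> A -> dist R S }.

Section representation_error.
Context (R : realType) (S A Z : finType) (M : mdp R S A) (d_off : dist R S)
  (L : latent_model S A Z (r_max M)).
Local Open Scope ereal_scope.

Definition offline_mean (f : S -> A -> \bar R) : \bar R :=
  \sum_(s : S) \sum_(a : A) (d_off s * #|A|%:R^-1)%:E * f s a.

Definition J_R : \bar R :=
  sqrte (offline_mean (fun s a =>
    ((reward M s a - reward_Z L (latent_repr L s) a) ^+ 2)%:E)).

(* +oo when some KL divergence of positive weight is infinite *)
Definition J_T : \bar R :=
  sqrte ((2^-1)%:E * offline_mean (fun s a =>
    KL_div (trans M s a) (trans_Z L (latent_repr L s) a))).

Definition repr_error : \bar R :=
  (#|A|%:R / (1 - discount M))%:E * J_R +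
  (2 * discount M * #|A|%:R * r_max M / (1 - discount M) ^+ 2)%:E * J_T.

End representation_error.
Arguments repr_error {R S A Z} M d_off L.

Section behavioral_cloning.
Context (R : realType) (S A Z : finType) (phi : S -> Z).
Context (N : nat) (D : N.-tuple (S * A)).

Definition count_repr (z : Z) : nat :=
  #|[set i : 'I_N | phi (tnth D i).1 == z]%SET|.

Definition count_repr_act (z : Z) (a : A) : nat :=
  #|[set i : 'I_N | (phi (tnth D i).1 == z) && ((tnth D i).2 == a)]%SET|.

Definition bc_pmf (dflt : Z -> dist R A) (z : Z) (a : A) : R :=
  if count_repr z == 0%N then dflt z a
  else (count_repr_act z a)%:R / (count_repr z)%:R.

Lemma bc_ge0 dflt z a : 0 <= bc_pmf dflt z a.
Proof.
by rewrite /bc_pmf; case: ifP => _; rewrite ?dist_ge0// divr_ge0.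
Qed.

Lemma bc_sum1 dflt z : \sum_a bc_pmf dflt z a = 1.
Proof.
rewrite /bc_pmf; case: eqP => [_|/eqP nz]; first exact: dist_sum1.
rewrite -mulr_suml -natr_sum.
suff -> : (\sum_a count_repr_act z a)%N = count_repr z.
  by rewrite divff// pnatr_eq0.
rewrite /count_repr -sum1_card (partition_big (fun i => (tnth D i).2) predT)//=.
apply: eq_bigr => a _; rewrite sum1_card /count_repr_act.
by apply: eq_card => i; rewrite !inE unfold_in /= !inE.
Qed.

(* [dflt] gives the action distributions at the values z that phi takes on no
   demonstration state *)
Definition bc_policy (dflt : Z -> dist R A) : policy R Z A :=
  fun z => Dist (@bc_ge0 dflt z) (bc_sum1 dflt z).

End behavioral_cloning.

Definition lift_policy (R : realType) (S A Z : finType) (phi : S -> Z)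
  (pi_Z : policy R Z A) : policy R S A := fun s => pi_Z (phi s).

(* Main.v *)
Require Import Defs.
From mathcomp Require Import all_boot all_order all_algebra.
From mathcomp Require Import all_classical all_reals all_analysis.
From mathcomp Require Import measurable_realfun ring lra.

(* Let d be the visitation distribution of pi_star and V the value function of
   the cloned policy. By the performance difference lemma the gap is, up to the
   factor 1 / (1 - gamma), the mean under d of sum_a (pi_star - pi_N)(a|s) Q(s, a)
   with Q = R + gamma P V. Replacing Q by its latent model Q_Z = R_Z + gamma P_Z V
   costs at most |A| times the mean model error; that error is moved from d to
   d_off by Cauchy-Schwarz (whence the chi-square factor) and the transition part
   is bounded through Pinsker's inequality. Since Q_Z depends on s only through
   phi, what remains is at most R_max / (1 - gamma)^2 times the l1 distance on
   Z x A between the law of (phi(s), a) and its behavioral-cloning estimate. This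
   is at most twice the l1 deviation of empirical frequencies, whose expectation
   is at most sqrt (|Z| |A| / N). The dependence of Q_Z on the demonstrations is
   harmless because only its uniform bound is used. *)

Set Implicit Arguments.
Unset Strict Implicit.
Unset Printing Implicit Defensive.

Import Order.TTheory GRing.Theory Num.Theory.
Import numFieldNormedType.Exports.

Local Open Scope classical_set_scope.
Local Open Scope ring_scope.

(** * Inequalities for finite distributions *)

Lemma dist_le1 (R : realType) (T : finType) (p : dist R T) (x : T) : p x <= 1.
Proof.
rewrite -(dist_sum1 p) (bigD1 x)//= lerDl.
by apply: sumr_ge0 => *; exact: dist_ge0.
Qed.

Lemma dist_mean_le (R : realType) (T : finType) (p : dist R T) (f : T -> R) (K : R) :
  (forall x, `|f x| <= K) -> `|\sum_x p x * f x| <= K.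
Proof.
move=> fK; apply: le_trans (ler_norm_sum _ _ _) _.
rewrite -[K]mul1r -(dist_sum1 p) mulr_suml; apply: ler_sum => x _.
by rewrite normrM ger0_norm ?dist_ge0// ler_wpM2l ?dist_ge0.
Qed.

(** Cauchy-Schwarz without roots or quotients. Since (c_i c_j)^2 <= (a_i b_j)(a_j b_i), the
    inequality between arithmetic and geometric means gives 2 c_i c_j <= a_i b_j + a_j b_i; summing
    over all pairs (i, j) yields twice the claim. *)
Lemma sqr_sum_le (R : realFieldType) (I : finType) (a b c : I -> R) :
  (forall i, 0 <= a i) -> (forall i, 0 <= b i) ->
  (forall i, c i ^+ 2 <= a i * b i) ->
  (\sum_i c i) ^+ 2 <= (\sum_i a i) * \sum_i b i.
Proof.
move=> a0 b0 cab.
have cross i j : c i * c j *+ 2 <= a i * b j + a j * b i.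
  rewrite real_ler_normlW ?num_real//= -ler_sqr ?nnegrE ?addr_ge0 ?mulr_ge0//.
  rewrite real_normK ?num_real//.
  have := ler_pM (sqr_ge0 _) (sqr_ge0 _) (cab i) (cab j).
  have := sqr_ge0 (a i * b j - a j * b i); nra.
rewrite -(ler_pMn2r (ltn0Sn 1)) expr2 !big_distrlr /=.
have -> : (\sum_i \sum_j a i * b j) *+ 2 = \sum_i \sum_j (a i * b j + a j * b i).
  rewrite mulr2n [X in _ + X]exchange_big -big_split /=.
  by apply: eq_bigr => i _; rewrite -big_split.
rewrite -sumrMnl; apply: ler_sum => i _; rewrite -sumrMnl.
by apply: ler_sum => j _; exact: cross.
Qed.

Lemma sqr_mean_le (R : realFieldType) (I : finType) (p f : I -> R) :
  (forall i, 0 <= p i) -> \sum_i p i = 1 ->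
  (\sum_i p i * f i) ^+ 2 <= \sum_i p i * f i ^+ 2.
Proof.
move=> p0 p1; rewrite -[leRHS]mul1r -p1; apply: sqr_sum_le => // i.
  by rewrite mulr_ge0 ?sqr_ge0.
by rewrite le_eqVlt; apply/orP; left; apply/eqP; ring.
Qed.

(* At q i = 0 the chi-square summand is the junk value 0, its true value since p i = 0. *)
Lemma change_of_measure_le (R : realType) (I : finType) (p q f : I -> R) :
  (forall i, 0 <= p i) -> (forall i, 0 <= q i) -> \sum_i q i = 1 ->
  (forall i, q i = 0 -> p i = 0) ->
  \sum_i p i * f i <= (1 + Num.sqrt (\sum_i (p i - q i) ^+ 2 / q i)) *
    Num.sqrt (\sum_i q i * f i ^+ 2).
Proof.
move=> p0 q0 q1 pq; set F := \sum_i q i * f i ^+ 2.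
set chi := \sum_i (p i - q i) ^+ 2 / q i.
have F0 : 0 <= F by apply: sumr_ge0 => i _; rewrite mulr_ge0 ?sqr_ge0.
have chi0 : 0 <= chi by apply: sumr_ge0 => i _; rewrite divr_ge0 ?sqr_ge0.
have sqrt_bound (x y : R) : x ^+ 2 <= y -> x <= Num.sqrt y.
  move=> xy; apply: le_trans (ler_norm x) _.
  by rewrite -sqrtr_sqr ler_sqrt// (le_trans (sqr_ge0 x) xy).
(* Jensen's inequality handles the mean under q; Cauchy-Schwarz with (p - q)^2 / q against q f^2
   handles the correction. *)
have -> : \sum_i p i * f i = \sum_i q i * f i + \sum_i (p i - q i) * f i.
  by rewrite -big_split; apply: eq_bigr => i _ /=; ring.
rewrite mulrDl mul1r lerD//; first by apply: sqrt_bound; exact: sqr_mean_le.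
rewrite -sqrtrM//; apply: sqrt_bound; apply: sqr_sum_le => i.
- by rewrite divr_ge0 ?sqr_ge0.
- by rewrite mulr_ge0 ?sqr_ge0.
- have [qi|qi] := eqVneq (q i) 0; first by rewrite qi pq// subrr !mul0r mulr0 expr0n.
  by rewrite le_eqVlt; apply/orP; left; apply/eqP; field.
Qed.

(** * Pinsker's inequality *)

Section pinsker.
Variable R : realType.

Let mean_value_pos (f df : R -> R) : (forall x : R, 0 < x -> is_derive x 1 f (df x)) ->
  forall a b, 0 < a -> a < b ->
    exists2 c, a < c < b & f b - f a = df c * (b - a).
Proof.
move=> fd a b a0 ab.
have [||c] := @MVT _ f df a b ab.
- move=> x; rewrite in_itv/= => /andP[ax _]; exact/fd/(lt_trans a0).
- apply: derivable_within_continuous => x; rewrite in_itv/= => /andP[ax _].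
  by have [] := fd x (lt_le_trans a0 ax).
- by rewrite in_itv/= => cab ->; exists c.
Qed.

(** Comparison of ln x with its Padé approximant 2 (x - 1) / (x + 1); the factor x - 1 treats both
    sides of 1 at once. The second factor vanishes at 1 and has derivative ln x + 1/x - 1 >= 0, so
    the mean value theorem applies. *)
Lemma ln_pade (x : R) : 0 < x -> 0 <= (x - 1) * ((x + 1) * ln x - 2 * (x - 1)).
Proof.
pose f (x : R) := (x + 1) * ln x - 2 * (x - 1).
have fd (y : R) : 0 < y -> is_derive y 1 f (ln y + y^-1 - 1).
  move=> y0; have ? := is_derive1_ln y0.
  have -> : f = ((id : R -> R) + cst 1) * (@ln R : R -> R) - 2 *: ((id : R -> R) - cst 1) by [].
  apply: is_derive_eq.
  have : y * y^-1 = 1 by rewrite mulfV// gt_eqF.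
  (* Scalings and constant functions left by the derivative rules become plain arithmetic, readable
     by [lra]. *)
  change (y * y^-1 = 1 -> (y + 1) * y^-1 + ln y * (1 + 0) - 2 * (1 - 0) =
    ln y + y^-1 - 1); lra.
have df0 (y : R) : 0 < y -> 0 <= ln y + y^-1 - 1.
  move=> y0; have : ln (1 + (y^-1 - 1)) <= y^-1 - 1.
    by apply: le_ln1Dx; rewrite ltrBDr addNr invr_gt0.
  rewrite (_ : 1 + (y^-1 - 1) = y^-1); last by ring.
  by rewrite lnV ?posrE// => h; lra.
have f1 : f 1 = 0 by rewrite /f ln1; ring.
have pos (c : R) : 0 < c -> 0 <= (x - 1) * ((ln c + c^-1 - 1) * (x - 1)).
  by move=> c0; rewrite mulrCA -expr2 mulr_ge0 ?sqr_ge0// df0.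
move=> x0; rewrite -/(f x).
have [x1|x1|->] := ltgtP x 1.
- have [c /andP[xc _]] := mean_value_pos fd x0 x1; rewrite f1 => fc.
  have -> : f x = (ln c + c^-1 - 1) * (x - 1) by lra.
  exact/pos/(lt_trans x0).
- have [c /andP[xc _]] := mean_value_pos fd ltr01 x1; rewrite f1 subr0 => ->.
  exact/pos/(lt_trans ltr01).
- by rewrite subrr mul0r.
Qed.

(** Pointwise form of Pinsker's inequality, to be used at x = p / q. The difference of the two sides
    vanishes at 1, and by [ln_pade] its derivative has the sign of x - 1. *)
Lemma sqr_le_xlnx (x : R) : 0 < x ->
  3 * (x - 1) ^+ 2 <= (4 + 2 * x) * (x * ln x - x + 1).
Proof.
pose f (x : R) := (4 + 2 * x) * (x * ln x - x + 1) - 3 * (x - 1) ^+ 2.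
pose df (x : R) := 4 * ((x + 1) * ln x - 2 * (x - 1)).
have fd (y : R) : 0 < y -> is_derive y 1 f (df y).
  move=> y0; have ? := is_derive1_ln y0.
  have -> : f = (cst 4 + 2 *: (id : R -> R)) *
      ((id : R -> R) * (@ln R : R -> R) - (id : R -> R) + cst 1) -
      3 *: (((id : R -> R) - cst 1) ^+ 2) by [].
  apply: is_derive_eq.
  have : y * y^-1 = 1 by rewrite mulfV// gt_eqF.
  rewrite /df => h.
  change ((4 + 2 * y) * (y * y^-1 + ln y * 1 - 1 + 0) +
    (y * ln y - y + 1) * (0 + 2 * 1) - 3 * ((2 * (y - 1)) * (1 - 0)) =
    4 * ((y + 1) * ln y - 2 * (y - 1))).
  by rewrite h; ring.
have f1 : f 1 = 0 by rewrite /f ln1; ring.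
move=> x0; rewrite -subr_ge0 -/(f x).
have dfE (y : R) : 0 < y -> 0 <= (y - 1) * df y.
  by move=> /ln_pade; rewrite /df; lra.
have [x1|x1|->] := ltgtP x 1.
- have [c /andP[xc c1]] := mean_value_pos fd x0 x1; rewrite f1 => fc.
  have -> : f x = df c * (x - 1) by lra.
  (* The intermediate point c lies on the same side of 1 as x, so the sign of [df c] is that of x -
     1. *)
  rewrite nmulr_lge0 ?subr_lt0// -(nmulr_rge0 _ (_ : c - 1 < 0)) ?subr_lt0//.
  exact/dfE/(lt_trans x0).
- have [c /andP[xc c1]] := mean_value_pos fd ltr01 x1; rewrite f1 subr0 => ->.
  rewrite pmulr_lge0 ?subr_gt0// -(pmulr_rge0 _ (_ : 0 < c - 1)) ?subr_gt0//.
  exact/dfE/(lt_trans ltr01).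
- by rewrite f1.
Qed.

Section finite.
Variable T : finType.
Implicit Types p q : T -> R.

Lemma KL_div_fin p q : (forall x, q x = 0 -> p x = 0) ->
  KL_div p q = (\sum_x p x * ln (p x / q x))%:E.
Proof.
move=> pq; rewrite /KL_div -sumEFin; apply: eq_bigr => x _.
have [->|px] := eqVneq (p x) 0; first by rewrite mul0r.
by case: eqVneq => [/pq/eqP|//]; rewrite (negbTE px).
Qed.

Lemma KL_div_pinfty p q x : p x != 0 -> q x = 0 -> KL_div p q = +oo%E.
Proof.
move=> px qx; apply/eqP; rewrite /KL_div esum_eqy /=; last first.
  by move=> y _; case: ifP => // _; case: ifP.
by apply/existsP; exists x; rewrite (negbTE px) qx eqxx.
Qed.

(* Cauchy-Schwarz with the weights (4 q + 2 p) / 3, of total mass 2, against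
   p ln (p / q) - p + q, which sums to the divergence. *)
Lemma pinsker p q : (forall x, 0 <= p x) -> (forall x, 0 <= q x) ->
  \sum_x p x = 1 -> \sum_x q x = 1 -> (forall x, q x = 0 -> p x = 0) ->
  (\sum_x `|p x - q x|) ^+ 2 <= 2 * \sum_x p x * ln (p x / q x).
Proof.
move=> p0 q0 p1 q1 pq.
pose a x := (4 * q x + 2 * p x) / 3.
pose b x := p x * ln (p x / q x) - p x + q x.
have ptw x : (p x - q x) ^+ 2 <= a x * b x.
  rewrite /a /b; have [qx|qx] := eqVneq (q x) 0.
    by rewrite qx pq//; nra.
  have {}qx : 0 < q x by rewrite lt_def qx q0.
  have [->|px] := eqVneq (p x) 0.
    by rewrite mul0r; have := sqr_ge0 (q x); nra.
  have {}px : 0 < p x by rewrite lt_def px p0.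
  have := sqr_le_xlnx (divr_gt0 px qx); set r := p x / q x => h.
  have -> : p x = r * q x by rewrite /r divfK// gt_eqF.
  (* Multiplying the scalar inequality at r = p / q by q^2 clears the quotients. *)
  have : 0 <= q x ^+ 2 * ((4 + 2 * r) * (r * ln r - r + 1) - 3 * (r - 1) ^+ 2).
    by rewrite mulr_ge0 ?sqr_ge0// subr_ge0.
  by rewrite -/r; nra.
have b0 x : 0 <= b x.
  have [qx|qx] := eqVneq (q x) 0; first by rewrite /b qx pq// !mul0r subrr addr0.
  (* Since a b >= (p - q)^2 >= 0 and a > 0, the sign of b comes for free. *)
  rewrite -(pmulr_rge0 _ (_ : 0 < a x)) ?(le_trans (sqr_ge0 _) (ptw x))//.
  have {}qx : 0 < q x by rewrite lt_def qx q0.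
  by rewrite /a; have := p0 x; lra.
apply: le_trans (sqr_sum_le (a := a) (b := b) _ _ _) _ => //.
- by move=> x; rewrite /a; have := p0 x; have := q0 x; lra.
- by move=> x; rewrite real_normK ?num_real.
rewrite /a /b -mulr_suml !big_split /= sumrN -!mulr_sumr p1 q1; lra.
Qed.

End finite.
End pinsker.

Lemma chi2_div_fin (R : realType) (T : finType) (p q : T -> R) :
  (forall x, q x = 0 -> p x = 0) ->
  chi2_div p q = (\sum_x (p x - q x) ^+ 2 / q x)%:E.
Proof.
move=> pq; rewrite /chi2_div -sumEFin; apply: eq_bigr => x _.
have [qx|//] := eqVneq (q x) 0.
by rewrite pq// qx eqxx subrr expr0n/= mul0r.
Qed.

(** * Trajectories and visitation distributions *)

Lemma measure_bigsetU_fintype d (X : measurableType d) (R : realType)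
    (mu : {measure set X -> \bar R}) (I : finType) (F : I -> set X) :
  (forall i, measurable (F i)) -> trivIset setT F ->
  mu (\big[setU/set0]_i F i) = (\sum_i mu (F i))%E.
Proof.
move=> mF tF; rewrite -bigcup_seq measure_fin_bigcup//=.
- by rewrite -fsbig_seq// index_enum_uniq.
- exact: sub_trivIset tF.
Qed.

Lemma big_tuple_rcons (V : nmodType) (T : finType) (n : nat)
    (F : n.+1.-tuple T -> V) :
  \sum_(u : n.+1.-tuple T) F u =
  \sum_(u : n.-tuple T) \sum_(x : T) F [tuple of rcons u x].
Proof.
rewrite pair_bigA /=.
have sz (u : n.+1.-tuple T) : size (belast (thead u) (behead u)) == n.
  by rewrite size_belast size_tuple.
pose h' (u : n.+1.-tuple T) : n.-tuple T * T :=
  (Tuple (sz u), last (thead u) (behead u)).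
rewrite (reindex (fun p : n.-tuple T * T => [tuple of rcons p.1 p.2]))//=.
have inj : injective (fun p : n.-tuple T * T => [tuple of rcons p.1 p.2]).
  move=> [u x] [v y] /(congr1 val)/= /rcons_inj[uv ->].
  by congr (_, _); apply: val_inj.
exists h' => [p _|u _].
  apply: inj; apply: val_inj => /=.
  rewrite -lastI; case: p => u x /=; rewrite /thead (tnth_nth x) /=.
  by case: u => -[].
apply: val_inj => /=; rewrite -lastI.
by rewrite [in RHS](tuple_eta u).
Qed.

Section trajectory_marginals.
Context (R : realType) (S A : finType) (M : mdp R S A) (pi : policy R S A).

Let P := traj_law M pi.
Let TX := stream_space (traj_point M pi).

(** The law of s_t by forward recursion. [traj_law_state] identifies it with the marginal of the
    trajectory measure, which reduces later arguments to finite sums. *)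
Fixpoint state_law (t : nat) (s : S) : R :=
  if t is t'.+1 then
    \sum_s' state_law t' s' * \sum_a pi s' a * trans M s' a s
  else init M s.

(** The Markov property for prefixes. [traj_prob] recurses from the front, so the last pair y is
    exposed to extend the prefix at its end. *)
Lemma traj_prob_rcons2 (v : seq (S * A)) (y x : S * A) :
  traj_prob M pi (rcons (rcons v y) x) =
  traj_prob M pi (rcons v y) * (trans M y.1 y.2 x.1 * pi x.1 x.2).
Proof.
have path v' s a : path_prob M pi s a (rcons (rcons v' y) x) =
    path_prob M pi s a (rcons v' y) * (trans M y.1 y.2 x.1 * pi x.1 x.2).
  elim: v' s a => [|[s' a'] v' IH] s a /=; last by rewrite IH mulrA.
  by case: x y => [s1 a1] [s2 a2]/=; rewrite !mulr1.
case: v => [|[s a] v] /=; last by rewrite path mulrA.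
by case: x y path => [s1 a1] [s2 a2]/=; rewrite !mulr1.
Qed.

Lemma traj_prob_marginal (t : nat) (x : S * A) :
  \sum_(u : t.-tuple (S * A)) traj_prob M pi (rcons u x) =
  state_law t x.1 * pi x.1 x.2.
Proof.
elim: t x => [|t IH] [s a] /=.
  rewrite (big_pred1 [tuple]) /= ?mulr1// => u.
  by apply/esym/eqP; rewrite tuple0.
rewrite big_tuple_rcons exchange_big /=.
under eq_bigr => y _.
  under eq_bigr => u _ do rewrite traj_prob_rcons2.
  rewrite -mulr_suml IH.
  over.
rewrite mulr_suml -(pair_bigA _ (fun s' a' => state_law t s' * pi s' a' *
  (trans M s' a' s * pi s a))) /=.
apply: eq_bigr => s' _; rewrite mulr_sumr mulr_suml.
by apply: eq_bigr => a' _; rewrite !mulrA.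
Qed.

Let measurable_prefix (v : seq (S * A)) :
  measurable ([set w | mkseq w (size v) = v] : set TX).
Proof. by apply: sub_sigma_algebra; exists v. Qed.

(** Only cylinders have prescribed probabilities, so an event at time t is split into the cylinders
    of length t + 1 that end in x. *)
Let at_bigcup (t : nat) (x : S * A) : [set w : TX | w t = x] =
  \big[setU/set0]_(u : t.-tuple (S * A))
    [set w : TX | mkseq w (size (rcons u x)) = rcons u x].
Proof.
apply/seteqP; split => w /=; rewrite -bigcup_seq.
  move=> wx; exists [tuple of mkseq w t]; rewrite /= ?mem_index_enum//.
  by rewrite size_rcons size_mkseq mkseqS wx.
move=> [u _ /=]; rewrite size_rcons mkseqS => /rcons_inj[_ <-].
by rewrite size_tuple.
Qed.

Lemma measurable_traj_at (t : nat) (x : S * A) :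
  measurable ([set w | w t = x] : set TX).
Proof.
rewrite at_bigcup; apply: bigsetU_measurable => u _.
exact: measurable_prefix.
Qed.

Lemma traj_law_at (t : nat) (x : S * A) :
  P [set w | w t = x] = (state_law t x.1 * pi x.1 x.2)%:E.
Proof.
rewrite at_bigcup measure_bigsetU_fintype//=.
- by rewrite -traj_prob_marginal -sumEFin; apply: eq_bigr => u _;
    exact: traj_law_prefix.
- apply/trivIsetP => u v _ _ uv; rewrite -subset0 => w [] /=.
  rewrite !size_rcons !size_tuple => -> /rcons_inj[/val_inj uv'].
  by move: uv; rewrite uv' eqxx.
Qed.

Lemma state_law_ge0 (t : nat) (s : S) : 0 <= state_law t s.
Proof.
elim: t s => [|t IH] s /=; first exact: dist_ge0.
apply: sumr_ge0 => s' _; rewrite mulr_ge0//.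
by apply: sumr_ge0 => a _; rewrite mulr_ge0// dist_ge0.
Qed.

Lemma state_law_sum1 (t : nat) : \sum_s state_law t s = 1.
Proof.
elim: t => [|t IH] /=; first exact: dist_sum1.
rewrite exchange_big /= -IH; apply: eq_bigr => s' _.
rewrite -mulr_sumr exchange_big /=.
under eq_bigr do rewrite -mulr_sumr dist_sum1 mulr1.
by rewrite dist_sum1 mulr1.
Qed.

Lemma traj_law_state (t : nat) (s : S) :
  P [set w | (w t).1 = s] = (state_law t s)%:E.
Proof.
have -> : [set w : TX | (w t).1 = s] =
    \big[setU/set0]_(a : A) [set w : TX | w t = (s, a)].
  apply/seteqP; split => w /=; rewrite -bigcup_seq.
    by move=> <-; exists (w t).2; rewrite /= ?mem_index_enum//; case: (w t).
  by move=> [a _ /= ->].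
rewrite measure_bigsetU_fintype//=.
- under eq_bigr do rewrite traj_law_at /=.
  by rewrite sumEFin -mulr_sumr dist_sum1 mulr1.
- by move=> a; exact: measurable_traj_at.
- apply/trivIsetP => a b _ _ ab; rewrite -subset0 => w [] /= -> -[ab'].
  by move: ab; rewrite ab' eqxx.
Qed.

Lemma measurable_traj_fun (f : S * A -> R) (t : nat) :
  measurable_fun setT (fun w : TX => f (w t)).
Proof.
have -> : (fun w : TX => f (w t)) =
    (fun w => \sum_x f x * \1_[set w : TX | w t = x] w).
  apply/funext => w; rewrite (bigD1 (w t))//= big1 ?addr0.
    by rewrite indicE mem_set// mulr1.
  move=> x xw; rewrite indicE memNset ?mulr0//= => wx.
  by move: xw; rewrite wx eqxx.
apply: measurable_sum => x; apply: measurable_funM => //.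
exact: measurable_indic (measurable_traj_at _ _).
Qed.

Lemma integral_traj_at (f : S * A -> R) (t : nat) :
  (\int[P]_w (f (w t))%:E = (\sum_s state_law t s * \sum_a pi s a * f (s, a))%:E)%E.
Proof.
have fE (w : TX) : ((f (w t))%:E =
    \sum_x (f x)%:E * (\1_[set w : TX | w t = x] w)%:E)%E.
  rewrite (bigD1 (w t))//= big1 ?adde0.
    by rewrite indicE mem_set// mule1.
  move=> x xw; rewrite indicE memNset ?mule0//= => wx.
  by move: xw; rewrite wx eqxx.
have mat x : measurable ([set w : TX | w t = x]) by exact: measurable_traj_at.
have int1 x : P.-integrable setT (fun w => (\1_[set w : TX | w t = x] w)%:E).
  by apply: integrable_indic => //; rewrite setIT.
under eq_integral do rewrite fE.
rewrite integral_sum//; last by move=> x; exact: integrableZl.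
under eq_bigr => x _.
  rewrite integralZl// integral_indic// setIT.
  rewrite [X in (_ * X)%E]traj_law_at -EFinM.
  over.
rewrite sumEFin; congr EFin.
rewrite (eq_bigr (fun x => f (x.1, x.2) * (state_law t x.1 * pi x.1 x.2)));
  last by case.
rewrite -(pair_bigA _ (fun s a => f (s, a) * (state_law t s * pi s a)))/=.
apply: eq_bigr => s _; rewrite mulr_sumr; apply: eq_bigr => a _.
by rewrite mulrC !mulrA.
Qed.

End trajectory_marginals.

(** * Discounted limits and the flow equation of the visitation distribution *)

Section discounted_sums.
Context (R : realType) (S A : finType) (M : mdp R S A).
Let g := discount M.
Let g0 : 0 <= g := discount_ge0 M.
Let g1 : 0 < 1 - g. Proof. by rewrite subr_gt0 discount_lt1. Qed.
Let g1N : 1 - g != 0. Proof. by rewrite gt_eqF. Qed.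

Lemma geometric_sum_le (n : nat) : \sum_(0 <= t < n) g ^+ t <= (1 - g)^-1.
Proof.
rewrite -[leLHS]mulr1 -[X in _ * X](divff g1N) mulrA ler_pdivrMr// mulVf//.
have -> : (\sum_(0 <= t < n) g ^+ t) * (1 - g) = 1 - g ^+ n.
  elim: n => [|n IH]; first by rewrite big_geq// mul0r expr0 subrr.
  by rewrite big_nat_recr//= mulrDl IH exprS; ring.
by rewrite gerBl exprn_ge0.
Qed.

Lemma discounted_sum_le (c : nat -> R) (K : R) (n : nat) :
  (forall t, `|c t| <= K) ->
  `|\sum_(0 <= t < n) g ^+ t * c t| <= K / (1 - g).
Proof.
move=> cK; have K0 : 0 <= K := le_trans (normr_ge0 _) (cK 0%N).
apply: le_trans (ler_norm_sum _ _ _) _.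
apply: (@le_trans _ _ (\sum_(0 <= t < n) g ^+ t * K)).
  apply: ler_sum => t _; rewrite normrM ger0_norm ?exprn_ge0//.
  by rewrite ler_wpM2l ?exprn_ge0.
by rewrite -mulr_suml mulrC ler_wpM2l// geometric_sum_le.
Qed.

Lemma discounted_is_cvg (c : nat -> R) (K : R) : (forall t, `|c t| <= K) ->
  cvgn (fun n => \sum_(0 <= t < n) g ^+ t * c t).
Proof.
move=> cK; have K0 : 0 <= K := le_trans (normr_ge0 _) (cK 0%N).
apply: (@normed_cvg _ _ (fun t => g ^+ t * c t)).
apply: (@series_le_cvg _ _ (geometric K g)) => [t|t|t|] /=.
- exact: normr_ge0.
- by rewrite mulr_ge0 ?exprn_ge0.
- by rewrite normrM ger0_norm ?exprn_ge0// mulrC ler_wpM2r ?exprn_ge0.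
- by apply: is_cvg_geometric_series; rewrite ger0_norm// discount_lt1.
Qed.

(** Exchange of expectation and infinite discounted sum by dominated convergence: every partial sum
    is at most K / (1 - g) in absolute value, an integrable constant. *)
Lemma Rintegral_discounted_cvg d (X : measurableType d) (P : probability X R)
    (h : nat -> X -> R) (K : R) :
  (forall t, measurable_fun setT (h t)) -> (forall t x, `|h t x| <= K) ->
  (fun n => \sum_(0 <= t < n) g ^+ t * \int[P]_x h t x) @ \oo -->
  \int[P]_x limn (fun n => \sum_(0 <= t < n) g ^+ t * h t x).
Proof.
move=> mh hK.
pose G n x := \sum_(0 <= t < n) g ^+ t * h t x.
pose L x := limn (G ^~ x).
have GL x : G ^~ x @ \oo --> L x by exact: (discounted_is_cvg (hK^~ x)).
have mgh t : measurable_fun setT (fun x => g ^+ t * h t x).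
  exact: measurable_funM.
have mG n : measurable_fun setT (G n) by exact: measurable_sum.
have mL : measurable_fun setT L by exact: (measurable_fun_cvg mG).
have inth t : P.-integrable setT (fun x => (h t x)%:E).
  apply: (@le_integrable _ _ _ _ _ measurableT _ (cst K%:E)) => //.
  - exact/measurable_EFinP.
  - by move=> x _; rewrite lee_fin [leRHS]ger0_norm// (le_trans _ (hK t x)).
  - exact: finite_measure_integrable_cst.
have [] := @dominated_convergence _ _ _ P setT measurableT
   (fun n x => (G n x)%:E) (fun x => (L x)%:E) (cst (K / (1 - g))%:E).
- by move=> n; exact/measurable_EFinP.
- exact/measurable_EFinP.
- by apply/aeW => x _; apply: cvg_EFin; [exact: nearW|exact: GL].
- exact: finite_measure_integrable_cst.
- by apply/aeW => x n _; rewrite lee_fin discounted_sum_le.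
move=> intL _.
rewrite (_ : (fun n => _) =
    EFin \o (fun n => \sum_(0 <= t < n) g ^+ t * \int[P]_x h t x)).
  rewrite -(fineK (_ : (\int[P]_x (L x)%:E)%E \is a fin_num)).
    by move=> /fine_cvgP[_]; exact.
  exact: integrable_fin_num intL.
apply/funext => n /=; rewrite /G -sumEFin.
under eq_integral do rewrite -sumEFin.
rewrite integral_sum//; last first.
  by move=> t; under eq_fun do rewrite EFinM; exact: integrableZl.
apply: eq_bigr => t _; under eq_integral do rewrite EFinM.
by rewrite integralZl// EFinM /Rintegral fineK//; exact: integrable_fin_num.
Qed.

Context (pi : policy R S A).
Let TX := stream_space (traj_point M pi).
Let mu := state_law M pi.

Lemma J_perf_cvg : (fun n => \sum_(0 <= t < n) g ^+ t *
    \sum_s mu t s * \sum_a pi s a * reward M s a) @ \oo --> J_perf M pi.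
Proof.
pose f (x : S * A) := reward M x.1 x.2.
have := @Rintegral_discounted_cvg _ _ (traj_law M pi)
  (fun t (w : TX) => f (w t)) (r_max M) _ _.
rewrite (_ : (fun n => _) = (fun n => \sum_(0 <= t < n) g ^+ t *
    \sum_s mu t s * \sum_a pi s a * reward M s a)).
  apply; first by move=> t; exact: measurable_traj_fun.
  by move=> t w; exact: reward_bound.
apply/funext => n; apply: eq_bigr => t _.
by rewrite /Rintegral integral_traj_at.
Qed.

Lemma state_law_le1 t s : mu t s <= 1.
Proof.
rewrite -(state_law_sum1 M pi t) (bigD1 s)//= lerDl.
by apply: sumr_ge0 => *; exact: state_law_ge0.
Qed.

Lemma visitation_cvg (s : S) :
  (fun n => \sum_(0 <= t < n) g ^+ t * mu t s) @ \oo -->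
  visitation M pi s / (1 - g).
Proof.
rewrite /visitation mulrAC divff// mul1r.
rewrite [X in _ --> limn X](_ : _ =
    fun n => \sum_(0 <= t < n) g ^+ t * mu t s).
  apply: (@discounted_is_cvg _ 1) => t.
  by rewrite ger0_norm ?state_law_ge0// state_law_le1.
apply/funext => n; apply: eq_bigr => t _.
by rewrite traj_law_state.
Qed.

Lemma visitation_mean_cvg (f : S -> R) :
  (fun n => \sum_(0 <= t < n) g ^+ t * \sum_s mu t s * f s) @ \oo -->
  (\sum_s visitation M pi s * f s) / (1 - g).
Proof.
rewrite mulr_suml; under eq_fun => n.
  under eq_bigr do rewrite mulr_sumr.
  rewrite exchange_big /=.
  under eq_bigr => s _.
    under eq_bigr do rewrite mulrA.
    rewrite -mulr_suml.
    over.
  over.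
apply: cvg_big => [|s _]; first exact: add_continuous.
by rewrite mulrAC; apply: cvgM; [exact: visitation_cvg|exact: cvg_cst].
Qed.

(** Both sides are limits of the same sequence of discounted mean rewards. *)
Lemma J_perfE : J_perf M pi =
  (\sum_s visitation M pi s * \sum_a pi s a * reward M s a) / (1 - g).
Proof.
apply: (cvg_unique _ J_perf_cvg) => //; exact: visitation_mean_cvg.
Qed.

Lemma visitation_ge0 (s : S) : 0 <= visitation M pi s.
Proof.
rewrite /visitation mulr_ge0 ?(ltW g1)//.
have := @visitation_cvg s => /cvgP h.
rewrite (_ : (fun _ => _) = fun n => \sum_(0 <= t < n) g ^+ t * mu t s).
  apply: limr_ge => //; apply: nearW => n; apply: sumr_ge0 => t _.
  by rewrite mulr_ge0 ?exprn_ge0// state_law_ge0.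
by apply/funext => n; apply: eq_bigr => t _; rewrite traj_law_state.
Qed.

Lemma visitation_sum1 : \sum_s visitation M pi s = 1.
Proof.
suff : (\sum_s visitation M pi s * 1) / (1 - g) = (1 - g)^-1.
  under eq_bigr do rewrite mulr1.
  by move=> /(congr1 ( *%R^~ (1 - g)))/=; rewrite divfK// mulVf.
apply: (cvg_unique _ (@visitation_mean_cvg (cst 1))) => //.
rewrite (_ : (fun _ => _) = series (geometric 1 g)).
  rewrite -[_^-1]mul1r; apply: cvg_geometric_series.
  by rewrite ger0_norm// discount_lt1.
apply/funext => n; apply: eq_bigr => t _ /=.
by under eq_bigr do rewrite mulr1; rewrite state_law_sum1 mulr1 mul1r.
Qed.

(** Split the term t = 0 off the discounted series and apply the recursion of [state_law] to the
    others; shifting the index by one does not change the limit. *)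
Lemma visitation_flow (s : S) : visitation M pi s =
  (1 - g) * init M s +
  g * \sum_s' visitation M pi s' * \sum_a pi s' a * trans M s' a s.
Proof.
suff : visitation M pi s / (1 - g) = init M s +
    g * ((\sum_s' visitation M pi s' * \sum_a pi s' a * trans M s' a s) / (1 - g)).
  move=> /(congr1 ( *%R (1 - g)))/=; rewrite mulrCA divff// mulr1 => ->.
  by field.
have h : (fun n => \sum_(0 <= t < n.+1) g ^+ t * mu t s) @ \oo -->
    visitation M pi s / (1 - g).
  by rewrite (cvg_shiftS (fun n => \sum_(0 <= t < n) g ^+ t * mu t s));
    exact: visitation_cvg.
apply: (cvg_unique _ h) => //.
rewrite (_ : (fun n => _) = fun n => init M s + g * \sum_(0 <= t < n)
    g ^+ t * \sum_s' mu t s' * \sum_a pi s' a * trans M s' a s).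
  apply: cvgD; first exact: cvg_cst.
  by apply: cvgM; [exact: cvg_cst|exact: visitation_mean_cvg].
apply/funext => n; rewrite big_nat_recl//= expr0 mul1r mulr_sumr.
by congr (_ + _); apply: eq_bigr => t _; rewrite exprS mulrA.
Qed.

End discounted_sums.

(** * Value functions and performance difference *)

Section value_function.
Context (R : realType) (S A : finType) (M : mdp R S A).
Let g := discount M.
Let g0 : 0 <= g := discount_ge0 M.
Let g1 : 0 < 1 - g. Proof. by rewrite subr_gt0 discount_lt1. Qed.

Definition bellman (pi : policy R S A) (V : S -> R) (s : S) : R :=
  \sum_a pi s a * (reward M s a + g * \sum_s' trans M s a s' * V s').

Lemma bellmanE (pi : policy R S A) (V : S -> R) (s : S) : bellman pi V s =
  \sum_a pi s a * reward M s a +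
  g * \sum_a pi s a * \sum_s' trans M s a s' * V s'.
Proof.
rewrite mulr_sumr -big_split /=.
by apply: eq_bigr => a _; rewrite mulrDr [g * (_ * _)]mulrCA.
Qed.

(** With K the maximum of |V|, the hypothesis gives K <= c + g K. The case c = 0 shows that the
    homogeneous Bellman equation has only the zero solution; c = [r_max M] bounds value
    functions. *)
Lemma discounted_bound (V : S -> R) (c : R) :
  (forall K, (forall s, `|V s| <= K) -> forall s, `|V s| <= c + g * K) ->
  forall s, `|V s| <= c / (1 - g).
Proof.
move=> h s0; pose K := \big[Num.max/`|V s0|]_s `|V s|.
have VK s : `|V s| <= K by apply: le_bigmax.
suff : K <= c + g * K.
  by move=> hK; apply: le_trans (VK s0) _; rewrite ler_pdivlMr//; lra.
by apply: bigmax_le => [|s _]; exact: h.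
Qed.

(** The value function is obtained by linear algebra: I - g P is invertible, because v = g P v
    forces v = 0 by contraction in the maximum norm. *)
Lemma bellman_solution (pi : policy R S A) : exists V, V =1 bellman pi V.
Proof.
pose n := #|S|.
pose P s s' := \sum_a pi s a * trans M s a s'.
have PV V s : \sum_a pi s a * (\sum_s' trans M s a s' * V s') =
    \sum_s' P s s' * V s'.
  under eq_bigr do rewrite mulr_sumr.
  rewrite exchange_big /=; apply: eq_bigr => s' _.
  by rewrite mulr_suml; apply: eq_bigr => a _; rewrite mulrA.
(* Functions are encoded as row vectors acted on from the right, so this is the transpose of I - g
   P. *)
pose B : 'M[R]_n := \matrix_(j, i)
  ((i == j)%:R - g * P (enum_val i) (enum_val j)).
pose fn (v : 'rV[R]_n) (s : S) := v 0 (enum_rank s).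
have vB (v : 'rV[R]_n) s :
    fn (v *m B) s = fn v s - g * \sum_s' P s s' * fn v s'.
  rewrite /fn mxE; under eq_bigr do rewrite mxE mulrBr.
  rewrite sumrB; congr (_ - _).
    rewrite (bigD1 (enum_rank s))//= eqxx mulr1 big1 ?addr0// => i.
    by rewrite eq_sym => /negbTE ->; rewrite mulr0.
  rewrite mulr_sumr (reindex (@enum_rank S))/=; last first.
    by apply: onW_bij; exact: enum_rank_bij.
  by apply: eq_bigr => s' _; rewrite !enum_rankK; ring.
have B_unit : B \in unitmx.
  rewrite -row_free_unit; apply: inj_row_free => v vB0.
  have fix_v s : fn v s = g * \sum_s' P s s' * fn v s'.
    by apply/eqP; rewrite -subr_eq0 -vB vB0 /fn mxE.
  have v0 : forall s, `|fn v s| <= 0 / (1 - g).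
    apply: discounted_bound => K vK s; rewrite add0r fix_v -PV normrM.
    rewrite (ger0_norm g0) ler_wpM2l//.
    by apply: dist_mean_le => a; exact: dist_mean_le.
  apply/rowP => i; rewrite mxE; apply/eqP; rewrite -normr_le0.
  by have := v0 (enum_val i); rewrite mul0r /fn enum_valK.
pose r : 'rV[R]_n := \row_i \sum_a pi (enum_val i) a * reward M (enum_val i) a.
exists (fn (r *m invmx B)) => s.
have := vB (r *m invmx B) s; rewrite mulmxKV// => /eqP.
rewrite eq_sym subr_eq => /eqP ->.
by rewrite bellmanE PV {1}/fn mxE enum_rankK.
Qed.

Lemma bellman_bound (pi : policy R S A) V : V =1 bellman pi V ->
  forall s, `|V s| <= r_max M / (1 - g).
Proof.
move=> VE; apply: discounted_bound => K VK s; rewrite VE.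
apply: dist_mean_le => a; apply: le_trans (ler_normD _ _) _.
apply: lerD; first exact: reward_bound.
by rewrite normrM ger0_norm// ler_wpM2l//; exact: dist_mean_le.
Qed.

(** Testing the flow equation against V expresses that the discounted sum of g V(s_{t+1}) - V(s_t)
    telescopes to - V(s_0) in mean. As V is arbitrary, the identity can be used for two policies
    with a common V. *)
Lemma J_perf_bellman_residual (pi : policy R S A) (V : S -> R) :
  J_perf M pi = \sum_s init M s * V s +
    (\sum_s visitation M pi s * (bellman pi V s - V s)) / (1 - g).
Proof.
rewrite J_perfE -/g; set d := visitation M pi.
have flow : \sum_s d s * V s = (1 - g) * (\sum_s init M s * V s) +
    g * \sum_s d s * \sum_a pi s a * \sum_s' trans M s a s' * V s'.
  under eq_bigr do rewrite /d visitation_flow -/d mulrDl -!mulrA.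
  rewrite big_split /= -!mulr_sumr; congr (_ + _ * _).
  transitivity (\sum_s \sum_s' d s' * (\sum_a pi s' a * trans M s' a s) * V s).
    by apply: eq_bigr => s _; rewrite mulr_suml.
  rewrite exchange_big /=; apply: eq_bigr => s' _.
  transitivity (d s' * \sum_s \sum_a pi s' a * trans M s' a s * V s).
    by rewrite mulr_sumr; apply: eq_bigr => s _; rewrite -mulrA mulr_suml.
  rewrite exchange_big /=; congr (_ * _); apply: eq_bigr => a _.
  by rewrite mulr_sumr; apply: eq_bigr => s _; rewrite mulrA.
have -> : \sum_s d s * (bellman pi V s - V s) =
    \sum_s d s * (\sum_a pi s a * reward M s a) +
    g * (\sum_s d s * \sum_a pi s a * \sum_s' trans M s a s' * V s') -
    \sum_s d s * V s.
  rewrite mulr_sumr -big_split -sumrB /=; apply: eq_bigr => s _.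
  by rewrite bellmanE; ring.
by rewrite flow; field; rewrite gt_eqF.
Qed.

(** In the residual identities of both policies for the same V, the initial terms cancel and the
    residual of [pi2] vanishes. *)
Lemma performance_difference (pi1 pi2 : policy R S A) V :
  V =1 bellman pi2 V ->
  J_perf M pi1 - J_perf M pi2 =
  (\sum_s visitation M pi1 s * \sum_a (pi1 s a - pi2 s a) *
     (reward M s a + g * \sum_s' trans M s a s' * V s')) / (1 - g).
Proof.
move=> VE; rewrite (J_perf_bellman_residual pi1 V) (J_perf_bellman_residual pi2 V).
rewrite [X in _ - (_ + X / _)]big1 ?mul0r ?addr0; last first.
  by move=> s _; rewrite -VE subrr mulr0.
rewrite addrAC subrr add0r; congr (_ / _); apply: eq_bigr => s _.
rewrite VE /bellman -sumrB; congr (_ * _); apply: eq_bigr => a _.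
by rewrite mulrBl.
Qed.

End value_function.

(** * Behavioral cloning *)

Section iid.
Context (R : realType) (X : finType) (w : X -> R).
Hypotheses (w0 : forall x, 0 <= w x) (w1 : \sum_x w x = 1).

Definition iid_prob (n : nat) (D : n.-tuple X) : R :=
  \prod_(i < n) w (tnth D i).

Lemma iid_prob_ge0 n (D : n.-tuple X) : 0 <= iid_prob D.
Proof. by apply: prodr_ge0 => i _. Qed.

Lemma iid_prob_rcons n (D : n.-tuple X) x :
  iid_prob [tuple of rcons D x] = iid_prob D * w x.
Proof. by rewrite /iid_prob -!(big_tuple _ _ _ predT) big_rcons. Qed.

Lemma iid_prob_sum1 n : \sum_(D : n.-tuple X) iid_prob D = 1.
Proof.
elim: n => [|n IH].
  rewrite (big_pred1 [tuple]) => [|D]; first by rewrite /iid_prob big_ord0.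
  by apply/esym/eqP; rewrite tuple0.
rewrite big_tuple_rcons -IH; apply: eq_bigr => D _.
under eq_bigr do rewrite iid_prob_rcons.
by rewrite -mulr_sumr w1 mulr1.
Qed.

Context (f : X -> R).
Hypothesis f_centered : \sum_x w x * f x = 0.

Let sum_rcons n (D : n.-tuple X) x :
  \sum_(y <- [tuple of rcons D x]) f y = \sum_(y <- D) f y + f x.
Proof. by rewrite /= big_rcons. Qed.

(** Adding one draw at the end contributes its second moment; the cross term vanishes because f is
    centered. *)
Lemma iid_sum_variance n :
  \sum_(D : n.-tuple X) iid_prob D * (\sum_(x <- D) f x) ^+ 2 =
  n%:R * \sum_x w x * f x ^+ 2.
Proof.
elim: n => [|n IH].
  rewrite mul0r big1// => D _.
  by rewrite tuple0 big_nil expr0n mulr0.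
rewrite big_tuple_rcons.
transitivity (\sum_(D : n.-tuple X) (iid_prob D * (\sum_(x <- D) f x) ^+ 2 +
    iid_prob D * \sum_x w x * f x ^+ 2)).
  apply: eq_bigr => D _; under eq_bigr do rewrite iid_prob_rcons sum_rcons.
  move: (\sum_(x <- D) f x) => s.
  transitivity (iid_prob D * s ^+ 2 * (\sum_x w x) +
      iid_prob D * s * 2 * (\sum_x w x * f x) +
      iid_prob D * \sum_x w x * f x ^+ 2); last first.
    by rewrite w1 f_centered mulr0 addr0 mulr1.
  rewrite !mulr_sumr -!big_split; apply: eq_bigr => x _.
  by rewrite /=; ring.
by rewrite big_split /= IH -mulr_suml iid_prob_sum1 mul1r -natr1 mulrDl mul1r.
Qed.

End iid.

(** Jensen's inequality passes to the variance (m - m^2) / N of a frequency. Dropping m^2 leaves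
    bounds that add up to 1 / N over a partition. *)
Lemma iid_frequency_deviation (R : realType) (X : finType) (w : X -> R)
    (N : nat) (B : pred X) : (forall x, 0 <= w x) -> \sum_x w x = 1 ->
    (0 < N)%N ->
  (\sum_(D : N.-tuple X) iid_prob w D *
     `|(\sum_(x | B x) w x) - (count B D)%:R / N%:R|) ^+ 2 <=
  (\sum_(x | B x) w x) / N%:R.
Proof.
move=> w0 w1 N0; set m := \sum_(x | B x) w x.
have NN : N%:R != 0 :> R by rewrite pnatr_eq0 -lt0n.
apply: le_trans (sqr_mean_le _ _ _) _.
- by move=> D; exact: iid_prob_ge0.
- exact: iid_prob_sum1.
pose f x : R := (B x)%:R - m.
have mE : \sum_x w x * (B x)%:R = m.
  rewrite /m [RHS]big_mkcond; apply: eq_bigr => x _.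
  by case: (B x); rewrite ?mulr1 ?mulr0.
have fc : \sum_x w x * f x = 0.
  under eq_bigr do rewrite mulrBr.
  by rewrite sumrB mE -mulr_suml w1 mul1r subrr.
have fD (D : N.-tuple X) : m - (count B D)%:R / N%:R =
    - (\sum_(x <- D) f x) / N%:R.
  rewrite /f sumrB big_const_seq count_predT size_tuple iter_addr_0.
  rewrite -sum1_count natr_sum.
  under [in LHS]eq_bigr do rewrite mulr1n.
  rewrite -mulr_natl [X in _ = - (X - _) / _](_ : _ =
    \sum_(x <- D | B x) 1); last first.
    by rewrite [RHS]big_mkcond; apply: eq_bigr => x _; case: (B x).
  by field.
under eq_bigr do rewrite real_normK ?num_real// fD exprMn sqrrN mulrA.
rewrite -mulr_suml iid_sum_variance//.
have -> : \sum_x w x * f x ^+ 2 = m - m ^+ 2.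
  transitivity (\sum_x (w x * (B x)%:R * (1 - m *+ 2) + w x * m ^+ 2)).
    by apply: eq_bigr => x _; rewrite /f; case: (B x) => /=; ring.
  by rewrite big_split /= -!mulr_suml mE w1; ring.
rewrite [leLHS](_ : _ = (m - m ^+ 2) / N%:R); last by field.
rewrite ler_wpM2r ?invr_ge0//.
by rewrite gerBl sqr_ge0.
Qed.

(** * Estimation error of the cloned policy *)

Section behavioral_cloning_error.
Context (R : realType) (S A Z : finType) (phi : S -> Z) (N : nat).
Hypothesis N_gt0 : (0 < N)%N.

Lemma count_repr_actE (D : N.-tuple (S * A)) z a :
  count_repr_act phi D z a =
  count (fun x : S * A => (phi x.1 == z) && (x.2 == a)) D.
Proof.
rewrite /count_repr_act -sum1_card -sum1_count big_tuple.
by apply: eq_bigl => i; rewrite inE.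
Qed.

Lemma sum_count_repr_act (D : N.-tuple (S * A)) z :
  (\sum_a count_repr_act phi D z a)%N = count_repr phi D z.
Proof.
rewrite /count_repr -sum1_card (partition_big (fun i => (tnth D i).2) predT)//=.
apply: eq_bigr => a _; rewrite sum1_card /count_repr_act.
by apply: eq_card => i; rewrite !inE unfold_in /= !inE.
Qed.

(** The product form avoids the quotient: at an unobserved z both counts vanish, so the identity
    also holds for the default distribution. *)
Lemma bc_joint (D : N.-tuple (S * A)) (dflt : Z -> dist R A) z a :
  (count_repr_act phi D z a)%:R =
  (count_repr phi D z)%:R * bc_policy phi D dflt z a.
Proof.
rewrite /bc_policy /= /bc_pmf; case: eqVneq => [k0|k0]; last first.
  by rewrite mulrCA divff ?mulr1// pnatr_eq0.
rewrite k0 mul0r; apply/eqP; rewrite pnatr_eq0 -leqn0 -k0 -sum_count_repr_act.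
by rewrite (bigD1 a)//= leq_addr.
Qed.

(* Both the empirical joint law and the product of the true law of z with
   pi_N(.|z) are compared with the true joint law m; the z-marginals differ by
   at most the joint deviation, hence the factor 2. *)
Lemma bc_error_le (D : N.-tuple (S * A)) (dflt : Z -> dist R A)
    (m : Z -> A -> R) :
  \sum_z \sum_a `|m z a - (\sum_b m z b) * bc_policy phi D dflt z a| <=
  2 * \sum_z \sum_a `|m z a - (count_repr_act phi D z a)%:R / N%:R|.
Proof.
rewrite mulr_sumr; apply: ler_sum => z _; rewrite mulr_natl mulr2n.
set p := bc_policy phi D dflt z.
set k : R := (count_repr phi D z)%:R / N%:R.
have mh a : (count_repr_act phi D z a)%:R / N%:R = k * p a.
  by rewrite (bc_joint D dflt) mulrAC.
have marg : k - \sum_b m z b =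
    - \sum_b (m z b - (count_repr_act phi D z b)%:R / N%:R).
  rewrite sumrB opprB; congr (_ - _).
  by rewrite -mulr_suml -natr_sum sum_count_repr_act.
apply: (@le_trans _ _ (\sum_a
  (`|m z a - (count_repr_act phi D z a)%:R / N%:R| +
   `|k - \sum_b m z b| * p a))).
  apply: ler_sum => a _; rewrite mh.
  rewrite -[X in _ + _ * X](ger0_norm (dist_ge0 p a)) -normrM.
  by apply: le_trans (ler_normD _ _); rewrite mulrBl addrA subrK.
rewrite big_split /= lerD2l -mulr_sumr (dist_sum1 p) mulr1 marg normrN.
exact: ler_norm_sum.
Qed.

(** The cell (z, a), of mass m, has mean deviation at most the root of m / N. Cauchy-Schwarz over
    the |Z| |A| cells, whose masses sum to 1, gives the bound. *)
Lemma bc_deviation (w : S * A -> R) : (forall x, 0 <= w x) ->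
  \sum_x w x = 1 ->
  \sum_(D : N.-tuple (S * A)) iid_prob w D * \sum_z \sum_a
    `|(\sum_(x | (phi x.1 == z) && (x.2 == a)) w x) -
      (count_repr_act phi D z a)%:R / N%:R| <=
  Num.sqrt (#|Z|%:R * #|A|%:R / N%:R).
Proof.
move=> w0 w1.
pose B (u : Z * A) (x : S * A) := (phi x.1 == u.1) && (x.2 == u.2).
pose c u := \sum_(D : N.-tuple (S * A)) iid_prob w D *
  `|(\sum_(x | B u x) w x) - (count (B u) D)%:R / N%:R|.
have -> : \sum_(D : N.-tuple (S * A)) iid_prob w D * \sum_z \sum_a
    `|(\sum_(x | (phi x.1 == z) && (x.2 == a)) w x) -
      (count_repr_act phi D z a)%:R / N%:R| = \sum_u c u.
  rewrite /c exchange_big; apply: eq_bigr => D _ /=; rewrite -mulr_sumr.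
  rewrite pair_bigA; congr (_ * _); apply: eq_bigr => u _.
  by rewrite count_repr_actE.
have c0 : 0 <= \sum_u c u.
  apply: sumr_ge0 => u _; apply: sumr_ge0 => D _.
  by rewrite mulr_ge0// iid_prob_ge0.
rewrite -(ger0_norm c0) -sqrtr_sqr ler_sqrt//.
pose b u := (\sum_(x | B u x) w x) / N%:R.
apply: le_trans (sqr_sum_le (a := fun=> 1) (b := b) _ _ _) _ => //.
- by move=> u; rewrite divr_ge0// sumr_ge0.
- by move=> u; rewrite mul1r; exact: iid_frequency_deviation.
rewrite sumr_const -mulr_suml mulrA card_prod natrM ler_wpM2r ?invr_ge0//.
rewrite -[leRHS]mulr1 ler_wpM2l ?mulr_ge0// -w1.
by rewrite [leRHS](partition_big (fun x => (phi x.1, x.2)) predT).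
Qed.

End behavioral_cloning_error.

(** * Representation error *)

Section latent_imitation.
Context (R : realType) (S A Z : finType) (M : mdp R S A).
Context (pi : policy R S A) (L : latent_model S A Z (r_max M)).
Let g := discount M.
Let g0 : 0 <= g := discount_ge0 M.
Let g1 : 0 < 1 - g. Proof. by rewrite subr_gt0 discount_lt1. Qed.
Let phi := latent_repr L.
Let d := visitation M pi.
Let vmax := r_max M / (1 - g).

Definition reward_gap (x : S * A) : R :=
  `|reward M x.1 x.2 - reward_Z L (phi x.1) x.2|.

Definition trans_gap (x : S * A) : R :=
  \sum_s' `|trans M x.1 x.2 s' - trans_Z L (phi x.1) x.2 s'|.

Definition latent_joint (z : Z) (a : A) : R :=
  \sum_(x : S * A | (phi x.1 == z) && (x.2 == a)) d x.1 * pi x.1 x.2.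

Let latent_jointE z a :
  latent_joint z a = \sum_(s | phi s == z) d s * pi s a.
Proof.
rewrite /latent_joint -(pair_big (fun s => phi s == z) (fun b => b == a)
  (fun s b => d s * pi s b)) /=.
by apply: eq_bigr => s _; rewrite big_pred1_eq.
Qed.

Let sum_latent_joint z : \sum_b latent_joint z b = \sum_(s | phi s == z) d s.
Proof.
under eq_bigr do rewrite latent_jointE.
rewrite exchange_big; apply: eq_bigr => s _ /=.
by rewrite -mulr_sumr dist_sum1 mulr1.
Qed.

(** Stated for every latent policy, so that it applies to a [piZ] computed from the
    demonstrations. *)
Lemma perf_diff_latent_le (piZ : policy R Z A) :
  perf_diff M (lift_policy phi piZ) pi <=
  (\sum_x d x.1 * (reward_gap x + g * vmax * trans_gap x)) / (1 - g) +
  vmax / (1 - g) *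
    \sum_z \sum_a `|latent_joint z a - (\sum_b latent_joint z b) * piZ z a|.
Proof.
have [V VE] := bellman_solution M (lift_policy phi piZ).
have Vb s : `|V s| <= vmax by exact: bellman_bound VE s.
(* This orientation averages states under the visitation of [pi], from which demonstrations are
   drawn, and leaves the value of the lifted policy inside. *)
rewrite /perf_diff distrC (performance_difference pi VE) -/g -/d.
pose q s a := reward M s a + g * \sum_s' trans M s a s' * V s'.
pose qZ z a := reward_Z L z a + g * \sum_s' trans_Z L z a s' * V s'.
have qZb z a : `|qZ z a| <= vmax.
  apply: le_trans (ler_normD _ _) _.
  apply: (@le_trans _ _ (r_max M + g * vmax)).
    apply: lerD; first exact: reward_Z_bound.
    by rewrite normrM ger0_norm// ler_wpM2l//; exact: dist_mean_le.
  by rewrite le_eqVlt; apply/orP; left; apply/eqP; rewrite /vmax; field;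
    rewrite gt_eqF.
have qgap s a : `|q s a - qZ (phi s) a| <=
    reward_gap (s, a) + g * vmax * trans_gap (s, a).
  have -> : q s a - qZ (phi s) a = (reward M s a - reward_Z L (phi s) a) +
      g * \sum_s' (trans M s a s' - trans_Z L (phi s) a s') * V s'.
    rewrite /q /qZ; under [in RHS]eq_bigr do rewrite mulrBl.
    by rewrite sumrB; ring.
  apply: le_trans (ler_normD _ _) _; rewrite lerD2l normrM ger0_norm// -mulrA.
  rewrite ler_wpM2l// mulr_sumr; apply: le_trans (ler_norm_sum _ _ _) _.
  by apply: ler_sum => s' _; rewrite normrM mulrC ler_wpM2r.
have -> : \sum_s d s * \sum_a (pi s a - lift_policy phi piZ s a) * q s a =
    \sum_s d s * (\sum_a (pi s a - piZ (phi s) a) * (q s a - qZ (phi s) a)) +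
    \sum_z \sum_a (latent_joint z a - (\sum_b latent_joint z b) * piZ z a) *
      qZ z a.
  have -> : \sum_z \sum_a
      (latent_joint z a - (\sum_b latent_joint z b) * piZ z a) * qZ z a =
      \sum_s d s * (\sum_a (pi s a - piZ (phi s) a) * qZ (phi s) a).
    (* On a fiber of [phi] the latent quantities are constant, so d and d pi sum there to the law of
       z and the joint law of (z, a). *)
    rewrite [RHS](partition_big phi predT)//=; apply: eq_bigr => z _.
    transitivity (\sum_(s | phi s == z) \sum_a
        d s * ((pi s a - piZ z a) * qZ z a)); last first.
      by apply: eq_bigr => s /eqP ->; rewrite mulr_sumr.
    rewrite exchange_big; apply: eq_bigr => a _ /=.
    rewrite sum_latent_joint latent_jointE mulr_suml -sumrB mulr_suml.
    by apply: eq_bigr => s _; ring.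
  rewrite -big_split; apply: eq_bigr => s _ /=; rewrite -mulrDr -big_split.
  by congr (_ * _); apply: eq_bigr => a _ /=; rewrite /lift_policy; ring.
rewrite normrM [X in _ * X]ger0_norm ?invr_ge0 ?(ltW g1)//.
rewrite [X in _ <= _ + X]mulrAC -mulrDl ler_wpM2r ?invr_ge0 ?(ltW g1)//.
apply: le_trans (ler_normD _ _) _; apply: lerD.
  rewrite -(pair_bigA _ (fun s a => d s *
    (reward_gap (s, a) + g * vmax * trans_gap (s, a)))) /=.
  apply: le_trans (ler_norm_sum _ _ _) _; apply: ler_sum => s _.
  rewrite normrM ger0_norm ?visitation_ge0// -mulr_sumr.
  rewrite ler_wpM2l ?visitation_ge0//.
  apply: le_trans (ler_norm_sum _ _ _) _; apply: ler_sum => a _.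
  (* A difference of two probabilities is at most 1 in absolute value. This leaves an unweighted sum
     over actions, the source of the factor |A|. *)
  rewrite normrM -[leRHS]mul1r ler_pM// ler_norml.
  have := dist_le1 (pi s) a; have := dist_le1 (piZ (phi s)) a.
  have := dist_ge0 (pi s) a; have := dist_ge0 (piZ (phi s)) a; lra.
apply: le_trans (ler_norm_sum _ _ _) _; rewrite mulr_sumr.
apply: ler_sum => z _; apply: le_trans (ler_norm_sum _ _ _) _.
by rewrite mulr_sumr; apply: ler_sum => a _; rewrite normrM mulrC ler_wpM2r.
Qed.

(** * Transfer of the model error to the offline distribution *)

Context (d_off : dist R S).
Hypothesis supp_off : forall s : S, 0 < d s -> 0 < d_off s.

Let supp0 s : d_off s = 0 -> d s = 0.
Proof.
move=> s0; apply/eqP; rewrite eq_le visitation_ge0 andbT leNgt.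
by apply/negP => /supp_off; rewrite s0 ltxx.
Qed.

Let card_gt0 : 0 < #|A|%:R :> R.
Proof.
have s : S := dist_inhabited (init M).
by rewrite ltr0n; apply/card_gt0P; exists (dist_inhabited (pi s)).
Qed.

Let chi := \sum_s (d s - d_off s) ^+ 2 / d_off s.
Let off (x : S * A) : R := d_off x.1 * #|A|%:R^-1.

Let off_ge0 x : 0 <= off x.
Proof. by rewrite mulr_ge0 ?invr_ge0 ?(ltW card_gt0)// dist_ge0. Qed.

(** The sum over actions is |A| times a uniform mean, and a common uniform factor leaves the
    chi-square divergence unchanged. *)
Lemma offline_change_of_measure (f : S * A -> R) :
  \sum_x d x.1 * f x <= #|A|%:R *
    ((1 + Num.sqrt chi) * Num.sqrt (\sum_x off x * f x ^+ 2)).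
Proof.
have A0 : #|A|%:R != 0 :> R by rewrite gt_eqF.
pose p (x : S * A) := d x.1 * #|A|%:R^-1.
have -> : \sum_x d x.1 * f x = #|A|%:R * \sum_x p x * f x.
  by rewrite mulr_sumr; apply: eq_bigr => x _; rewrite /p; field.
have -> : chi = \sum_x (p x - off x) ^+ 2 / off x.
  rewrite -(pair_bigA _ (fun s a => (p (s, a) - off (s, a)) ^+ 2 / off (s, a))).
  apply: eq_bigr => s _ /=; rewrite /p /off /= sumr_const -[RHS]mulr_natl.
  rewrite -[#|xpredT|]/#|A|.
  have [->|ds] := eqVneq (d_off s) 0; first by rewrite !(mul0r, invr0, mulr0).
  by field; rewrite ds A0.
rewrite ler_wpM2l ?(ltW card_gt0)//; apply: change_of_measure_le => //.
- by move=> x; rewrite mulr_ge0 ?invr_ge0 ?(ltW card_gt0)// visitation_ge0.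
- rewrite -(pair_bigA _ (fun s a => off (s, a))) /off /= -[RHS](dist_sum1 d_off).
  apply: eq_bigr => s _; rewrite sumr_const -[LHS]mulr_natl.
  by rewrite -[#|xpredT|]/#|A|; field.
- move=> x /eqP; rewrite mulf_eq0 invr_eq0 (negbTE A0) orbF => /eqP/supp0.
  by rewrite /p => ->; rewrite mul0r.
Qed.

Lemma offline_meanE (f : S -> A -> \bar R) :
  offline_mean d_off f = (\sum_x (off x)%:E * f x.1 x.2)%E.
Proof. by rewrite /offline_mean pair_bigA. Qed.

Lemma J_RE :
  J_R d_off L = (Num.sqrt (\sum_x off x * reward_gap x ^+ 2))%:E.
Proof.
rewrite /J_R offline_meanE; under eq_bigr do rewrite -EFinM.
rewrite sumEFin /=; congr (Num.sqrt _)%:E; apply: eq_bigr => x _.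
by rewrite /reward_gap real_normK ?num_real.
Qed.

Let kl (x : S * A) : R := \sum_s' trans M x.1 x.2 s' *
  ln (trans M x.1 x.2 s' / trans_Z L (phi x.1) x.2 s').

(** If a divergence of positive weight is infinite, so is [J_T]. Otherwise Pinsker's inequality
    bounds [trans_gap] squared by twice the divergence; with the factor 1/2 in [J_T] this gives the
    division by 2. *)
Lemma J_T_ge :
  ((Num.sqrt (\sum_x off x * trans_gap x ^+ 2) / 2)%:E <= J_T d_off L)%E.
Proof.
pose ac (x : S * A) := `[< forall s',
  trans_Z L (phi x.1) x.2 s' = 0 -> trans M x.1 x.2 s' = 0 >].
have KLac x : ac x ->
    KL_div (trans M x.1 x.2) (trans_Z L (phi x.1) x.2) = (kl x)%:E.
  by move=> /asboolP; exact: KL_div_fin.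
have KLnac x : ~~ ac x ->
    KL_div (trans M x.1 x.2) (trans_Z L (phi x.1) x.2) = +oo%E.
  move=> /asboolPn/existsNP[s' /not_implyP[qs /eqP ps]].
  exact: KL_div_pinfty ps qs.
rewrite /J_T offline_meanE -/phi.
have [/existsP[x /andP[xn ox]]|/existsPn fin] :=
    boolP [exists x, (~~ ac x) && (off x != 0)].
  rewrite (_ : (\sum_x _)%E = +oo%E) ?gt0_muley ?lte_fin ?leey//.
  apply/eqP; rewrite esum_eqy /=.
    apply/existsP; exists x; rewrite KLnac// gt0_muley//.
    by rewrite lte_fin lt_def ox off_ge0.
  move=> y _; have [yac|yn] := boolP (ac y); first by rewrite KLac.
  rewrite KLnac//; have [->|oy] := eqVneq (off y) 0; first by rewrite mul0e.
  by rewrite gt0_muley// lte_fin lt_def oy off_ge0.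
(* A remaining infinite divergence has weight 0, and its product with 0 is 0. *)
rewrite (eq_bigr (fun x => (off x * kl x)%:E)); last first.
  move=> x _; have := fin x; rewrite negb_and !negbK => /orP[xac|/eqP ->].
    by rewrite KLac// EFinM.
  by rewrite mul0e mul0r.
rewrite sumEFin -EFinM /= lee_fin ler_pdivrMr//.
have le2 : \sum_x off x * trans_gap x ^+ 2 <= 2 * \sum_x off x * kl x.
  rewrite mulr_sumr; apply: ler_sum => x _.
  have := fin x; rewrite negb_and !negbK => /orP[/asboolP xac|/eqP ->].
    rewrite [leRHS]mulrCA ler_wpM2l//.
    by apply: pinsker; rewrite ?dist_sum1// => s; exact: dist_ge0.
  by rewrite !mul0r mulr0.
have sum0 : 0 <= \sum_x off x * trans_gap x ^+ 2.
  by apply: sumr_ge0 => x _; rewrite mulr_ge0// sqr_ge0.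
rewrite -[X in _ * X](@ger0_norm R 2)// -sqrtr_sqr mulrC -sqrtrM ?sqr_ge0//.
by rewrite ler_sqrt; lra.
Qed.

Lemma offline_gap_le :
  (((\sum_x d x.1 * (reward_gap x + g * vmax * trans_gap x)) / (1 - g))%:E <=
   (1 + sqrte (chi2_div d d_off)) * repr_error M d_off L)%E.
Proof.
have rmax0 : 0 <= r_max M.
  have s : S := dist_inhabited (init M).
  exact: le_trans (normr_ge0 _) (reward_bound M s (dist_inhabited (pi s))).
set jr := Num.sqrt (\sum_x off x * reward_gap x ^+ 2).
set jt := Num.sqrt (\sum_x off x * trans_gap x ^+ 2) / 2.
pose k := 1 + Num.sqrt chi.
have k0 : 0 <= k by rewrite addr_ge0// sqrtr_ge0.
rewrite chi2_div_fin// -[(1 + _)%E]/(k%:E).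
(* Replacing [J_T] by its real lower bound [jt] reduces the claim to real numbers, even when [J_T]
   is infinite. *)
apply: (@le_trans _ _ (k%:E * ((#|A|%:R / (1 - g))%:E * jr%:E +
    (2 * g * #|A|%:R * r_max M / (1 - g) ^+ 2)%:E * jt%:E))%E); last first.
  rewrite lee_wpmul2l ?lee_fin// /repr_error J_RE leeD2l//.
  rewrite lee_wpmul2l ?J_T_ge// lee_fin.
  by rewrite divr_ge0 ?sqr_ge0// !mulr_ge0 ?(ltW card_gt0).
rewrite -(EFinM _ jr) -(EFinM _ jt) -EFinD -EFinM lee_fin.
have -> : k * (#|A|%:R / (1 - g) * jr +
    2 * g * #|A|%:R * r_max M / (1 - g) ^+ 2 * jt) =
  (#|A|%:R * (k * jr) + g * vmax * (#|A|%:R * (k * (jt * 2)))) / (1 - g).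
  by rewrite /vmax; field; rewrite gt_eqF.
rewrite ler_wpM2r ?invr_ge0 ?(ltW g1)//.
under eq_bigr do rewrite mulrDr mulrCA.
rewrite big_split -mulr_sumr /= /jt divfK ?pnatr_eq0//.
apply: lerD; first exact: offline_change_of_measure.
rewrite ler_wpM2l ?offline_change_of_measure// mulr_ge0// divr_ge0//.
exact: ltW.
Qed.

End latent_imitation.

(** * Combination of representation error and estimation error *)

Theorem theorem4 (R : realType) (S A Z : finType) (M : mdp R S A)
    (pi_star : policy R S A) (d_off : dist R S)
    (supp_off : forall s : S, 0 < visitation M pi_star s -> 0 < d_off s)
    (m : nat)
    (opt : m.-tuple (transition_tuple R S A) -> latent_model S A Z (r_max M))
    (D_off : m.-tuple (transition_tuple R S A))
    (D_off_sampled : 0 < offline_prob M d_off D_off)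
    (N : nat) (N_gt0 : (0 < N)%N) (dflt : Z -> dist R A) :
  let phi_m := latent_repr (opt D_off) in
  let C := 2 * r_max M / (1 - discount M) ^+ 2 in
  ((demo_expectation M pi_star (fun D : N.-tuple (S * A) =>
      perf_diff M (lift_policy phi_m (bc_policy phi_m D dflt)) pi_star))%:E
   <= (1 + sqrte (chi2_div (visitation M pi_star) d_off))
        * repr_error M d_off (opt D_off)
      + (C * Num.sqrt (#|Z|%:R * #|A|%:R / N%:R))%:E)%E.
Proof.
cbv zeta; set L := opt D_off; set phi := latent_repr L.
set C := 2 * r_max M / (1 - discount M) ^+ 2.
pose w (x : S * A) := visitation M pi_star x.1 * pi_star x.1 x.2.
have w0 x : 0 <= w x by rewrite mulr_ge0 ?visitation_ge0 ?dist_ge0.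
have w1 : \sum_x w x = 1.
  rewrite -(visitation_sum1 M pi_star).
  rewrite -(pair_bigA _ (fun s a => visitation M pi_star s * pi_star s a)) /=.
  by apply: eq_bigr => s _; rewrite -mulr_sumr dist_sum1 mulr1.
have g1 : 0 < 1 - discount M by rewrite subr_gt0 discount_lt1.
have rmax0 : 0 <= r_max M.
  have s : S := dist_inhabited (init M).
  exact: le_trans (normr_ge0 _) (reward_bound M s (dist_inhabited (pi_star s))).
have := offline_gap_le L supp_off; set B := (X in (X%:E <= _)%E) => leB.
apply: le_trans (leeD2r _ leB); rewrite -EFinD lee_fin.
pose dev (D : N.-tuple (S * A)) : R := \sum_z \sum_a
  `|latent_joint pi_star L z a - (count_repr_act phi D z a)%:R / N%:R|.
have K0 : 0 <= C by rewrite divr_ge0 ?sqr_ge0// mulr_ge0.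
(* The factor [r_max M] / (1 - gamma)^2 and the 2 of [bc_error_le] make up C; B is the same for all
   demonstrations. *)
have pd D : perf_diff M (lift_policy phi (bc_policy phi D dflt)) pi_star <=
    B + C * dev D.
  apply: le_trans (perf_diff_latent_le pi_star L _) _; rewrite lerD2l.
  apply: le_trans (ler_wpM2l _ (bc_error_le phi D dflt _)) _.
    by rewrite !divr_ge0// ltW.
  rewrite le_eqVlt; apply/orP; left; apply/eqP.
  by rewrite /C -/(dev D); field; rewrite gt_eqF.
(* [demo_prob] is [iid_prob w] by conversion. *)
apply: (@le_trans _ _ (\sum_D iid_prob w D * (B + C * dev D))).
  by apply: ler_sum => D _; rewrite ler_wpM2l//; exact: (iid_prob_ge0 w0).
under eq_bigr do rewrite mulrDr [_ * (C * _)]mulrCA.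
rewrite big_split /= -mulr_suml iid_prob_sum1// mul1r lerD2l -mulr_sumr.
by rewrite ler_wpM2l//; exact: bc_deviation.
Qed.
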